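(* For any tree $T$ of order at least $2$, $\gamma_{tm}(T)=2$ if and only if $\mathrm{diam}(T)\leq 3$.
   Context: All graphs are non-empty, finite, undirected and simple; $\mathrm{diam}(G)$ is the maximum distance between pairs of vertices of $G$. A total mixed dominating set of a graph $G=(V,E)$ with minimum degree at least $1$ is a set $S\subseteq V\cup E$ such that every element of $V\cup E$ (including those in $S$) is adjacent or incident to an element of $S$ (two vertices are adjacent if joined by an edge; two distinct edges are adjacent if they share an endpoint; a vertex and an edge are incident if the vertex is an endpoint of the edge; no element is adjacent or incident to itself). The total mixed domination number $\gamma_{tm}(G)$ is the minimum cardinality of a total mixed dominating set. *)

(* Defs.v *)
From mathcomp Require Import all_boot.

Set Implicit Arguments.
Unset Strict Implicit.
Unset Printing Implicit Defensive.

Record sgraph := SGraph {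
  vertex :> finType;
  adj : rel vertex;
  adj_sym : symmetric adj;
  adj_irrefl : irreflexive adj;
  sgraph_nonempty : 0 < #|vertex|
}.

Section Graph.

Variable G : sgraph.

Definition edges : {set {set G}} := [set [set x; y] | x in G, y in G & adj x y].

Definition gconnected : Prop := forall x y : G, connect (@adj G) x y.

(* A one-vertex list is never a cycle, by irreflexivity, but [:: x; y] with x
   and y adjacent satisfies ucycle, hence the bound 2. *)
Definition acyclic : Prop := forall c : seq G, ucycle (@adj G) c -> size c <= 2.

Definition is_tree : Prop := gconnected /\ acyclic.

Definition has_path (x y : G) (n : nat) : bool :=
  [exists p : n.-tuple G, [&& path (@adj G) x p, last x p == y & uniq (x :: p)]].

(* A path has fewer than #|G| edges, so the bound on n loses nothing; the value
   is #|G| when x and y are in different components. *)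
Definition dist (x y : G) : nat :=
  \big[minn/#|G|]_(n < #|G| | has_path x y n) n.

Definition diam : nat := \max_(x : G) \max_(y : G) dist x y.

(* The disjoint union of V and E, inside the type of vertices and vertex sets. *)
Definition elements : {set G + {set G}} :=
  [set z | match z with inl _ => true | inr f => f \in edges end].

Definition adj_or_inc (a b : G + {set G}) : bool :=
  match a, b with
  | inl x, inl y => adj x y
  | inl x, inr f => x \in f
  | inr f, inl x => x \in f
  | inr f, inr g => (f != g) && (f :&: g != set0)
  end.

Definition total_mixed_dominating (S : {set G + {set G}}) : bool :=
  (S \subset elements) &&
  [forall a in elements, [exists b in S, adj_or_inc a b]].

(* Meaningful when G has no isolated vertex; see gamma_tm_spec. *)
Definition gamma_tm : nat :=
  #|[arg min_(S < elements | total_mixed_dominating S) #|S|]|.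

Lemma elements_total_mixed_dominating :
  (forall x : G, exists y, adj x y) -> total_mixed_dominating elements.
Proof.
move=> noiso; rewrite /total_mixed_dominating subxx /=.
apply/forall_inP => -[x|f]; rewrite inE => fE; apply/exists_inP.
  by have [y xy] := noiso x; exists (inl y); rewrite ?inE.
case/imset2P: fE => x y _ _ ->; exists (inl x); first by rewrite inE.
by rewrite /= !inE eqxx.
Qed.

Lemma gamma_tm_spec :
  (forall x : G, exists y, adj x y) ->
  (exists2 S, total_mixed_dominating S & #|S| = gamma_tm) /\
  (forall S, total_mixed_dominating S -> gamma_tm <= #|S|).
Proof.
move=> /elements_total_mixed_dominating dE; rewrite /gamma_tm.
by case: arg_minnP => // S dS minS; split=> //; exists S.
Qed.

End Graph.

(* Main.v *)
Require Import Defs.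
From mathcomp Require Import all_boot.

(** Both sides say that the tree has a dominating edge, that is an edge uv such
    that every vertex is adjacent to u or to v.

    On the domination side, no element dominates itself, so gamma_tm is at least
    2, and a total mixed dominating set of size 2 consists of two elements that
    dominate each other: two adjacent vertices, a vertex and an edge through it,
    or two edges sharing a vertex. In each case a dominating edge can be read off
    ([pair_dominating_edge]). Conversely the two ends of a dominating edge form a
    total mixed dominating set ([dominating_edge_pair]): an edge missing both u
    and v would close a cycle of length 3 or 4 with them.

    On the metric side, a dominating edge gives a walk with at most 3 edges
    between any two vertices ([dominating_edge_diam]). Conversely, if the diameter
    is at most 3, an edge uv whose ends have the largest joint neighbourhood is
    dominating ([diam_dominating_edge]). Indeed, by connectedness it suffices that
    this neighbourhood is closed under adjacency. If it is not, there is, up to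
    exchanging u and v, a path w - z - u - v with w outside of it. Another
    neighbour y of v would extend this path to one with 4 edges, and paths in a
    tree are unique ([acyclic_path_unique]), so w and y would be at distance 4;
    hence v is a leaf, and then the edge zu has a strictly larger joint
    neighbourhood, which now contains w. *)

Set Implicit Arguments.
Unset Strict Implicit.
Unset Printing Implicit Defensive.

Section Theory.

Variable G : sgraph.
Implicit Types (x y u v w z : G) (p q : seq G) (a b : G + {set G}) (S : {set G + {set G}}).

Lemma adj_neq x y : adj x y -> x != y.
Proof. by apply: contraTneq => ->; rewrite adj_irrefl. Qed.

(** * Paths in acyclic graphs *)

(** If two paths from x leave it through distinct neighbours, following one and
    coming back along the other links these neighbours while avoiding x, since
    neither path returns to x; together with x this is a cycle. *)
Lemma acyclic_path_unique x p q :
  acyclic G -> path (@adj G) x p -> path (@adj G) x q ->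
  uniq (x :: p) -> uniq (x :: q) -> last x p = last x q -> p = q.
Proof.
move=> acG; elim: p x q => [|c p IHp] x [|d q] //.
- by move=> _ _ _ /= /andP[xq _] xE; rewrite xE mem_last in xq.
- by move=> _ _ /= /andP[xp _] _ xE; rewrite -xE mem_last in xp.
have [<-|c_d] := eqVneq c d.
  move=> /andP[_ pp] /andP[_ pq] /andP[_ up] /andP[_ uq] eq_last.
  by congr (_ :: _); apply: IHp pp pq up uq eq_last.
move=> /andP[xc pp] /andP[xd pq] /andP[xp up] /andP[xq uq] /= eq_last.
case: notF.
(* Adjacency in the graph with x removed. *)
pose e := [rel s t | [&& adj s t, s != x & t != x]].
have symE : connect_sym e.
  by apply: sym_connect_sym => s t /=; rewrite adj_sym [_ && (t != x)]andbC.
have conn s r : path (@adj G) s r -> x \notin s :: r -> connect e s (last s r).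
  elim: r s => [|t r IHr] s //= /andP[st pr].
  rewrite !inE !negb_or => /and3P[xs xt xr].
  apply: (connect_trans (y := t)); first by apply: connect1; rewrite /= st !(eq_sym _ x) xs.
  by apply: IHr => //; rewrite inE negb_or xt.
have: connect e c d.
  apply: connect_trans (conn _ _ pp xp) _.
  by rewrite eq_last symE; apply: conn.
case/connectP=> r0 /shortenP[r pr ur _] lr.
have er : path (@adj G) c r by apply: sub_path pr => s t /and3P[].
have xr : x \notin c :: r.
  rewrite inE negb_or (adj_neq xc) /=.
  elim: r c pr {xc pp xp up eq_last IHp conn c_d ur lr er} => //= t r IHr s.
  case/andP=> /and3P[_ _ tx] pr; rewrite inE negb_or eq_sym tx /=.
  exact: IHr pr.
have := acG (x :: c :: r); rewrite /ucycle /= rcons_path xc er -lr adj_sym xd.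
move: xr ur => /= -> ->; case: r lr {pr er} => [dc|t r _ /(_ isT) //].
by rewrite dc eqxx in c_d.
Qed.

Lemma acyclic_no_triangle x y z :
  acyclic G -> adj x y -> adj y z -> ~~ adj x z.
Proof.
move=> acG xy yz; apply/negP => xz.
have:= @acyclic_path_unique x [:: z] [:: y; z] acG.
rewrite /= xz xy yz !inE !negb_or (adj_neq xz) (adj_neq xy) (adj_neq yz).
by move=> /(_ isT isT isT isT erefl).
Qed.

(** * Distances and the diameter *)

Lemma has_pathP x y n :
  reflect (exists p, [/\ path (@adj G) x p, last x p = y, uniq (x :: p) & size p = n])
          (has_path x y n).
Proof.
apply: (iffP existsP) => [[t /and3P[pt /eqP lt ut]]|[p [pp lp up sp]]].
  by exists t; rewrite size_tuple.
have spE : size p == n by apply/eqP.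
by exists (Tuple spE); rewrite /= pp lp eqxx; move: up => /= ->.
Qed.

Lemma bigmin_leq (I : eqType) (s : seq I) (P : pred I) (F : I -> nat) d i :
  i \in s -> P i -> \big[minn/d]_(j <- s | P j) F j <= F i.
Proof.
move=> + Pi; elim: s => // j s IHs; rewrite inE big_cons => /predU1P[<-|/IHs le_i].
  by rewrite Pi geq_minl.
by case: ifP => // _; rewrite geq_min le_i orbT.
Qed.

Lemma uniq_size_lt x p : uniq (x :: p) -> size p < #|G|.
Proof. by move=> up; have := max_card (mem (x :: p)); rewrite (card_uniqP up). Qed.

Lemma dist_walk x p : path (@adj G) x p -> dist x (last x p) <= size p.
Proof.
case/shortenP=> q pq uq sub_qp.
have q_lt := uniq_size_lt uq.
have hq : has_path x (last x q) (Ordinal q_lt) by apply/has_pathP; exists q.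
have le_dist : dist x (last x q) <= size q.
  exact: (bigmin_leq (fun n => nat_of_ord n) _ (mem_index_enum (Ordinal q_lt)) hq).
by apply: leq_trans le_dist (uniq_leq_size _ sub_qp); case/andP: uq.
Qed.

(** A path has fewer than #|G| edges, so below #|G| the distance cannot be the
    default value of the minimum. *)
Lemma dist_has_path x y : dist x y < #|G| -> has_path x y (dist x y).
Proof.
suff [->|//] : dist x y = #|G| \/ has_path x y (dist x y) by rewrite ltnn.
apply: (big_ind (fun k => k = #|G| \/ has_path x y k)) => [|m n hm hn|i hi];
  [by left | | by right].
by case: (leqP m n) => _.
Qed.

Lemma dist_acyclic x p :
  acyclic G -> path (@adj G) x p -> uniq (x :: p) -> dist x (last x p) = size p.
Proof.
move=> acG pp up.
have p_lt := uniq_size_lt up.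
have /dist_has_path/has_pathP[q [pq lq uq <-]] := leq_ltn_trans (dist_walk pp) p_lt.
by rewrite (acyclic_path_unique acG pp pq up uq).
Qed.

Lemma leq_dist_diam x y : dist x y <= diam G.
Proof.
rewrite /diam; apply: leq_trans (leq_bigmax x).
exact: (leq_bigmax (F := dist x)).
Qed.

(** * Dominating edges *)

(** Since u and v are adjacent, being adjacent to one of them is the same as
    lying in the union of their closed neighbourhoods. *)
Definition dominating_edge u v : Prop :=
  adj u v /\ forall x, adj x u || adj x v.

Lemma dominating_edge_diam u v : dominating_edge u v -> diam G <= 3.
Proof.
move=> [uv dom]; apply/bigmax_leqP => x _; apply/bigmax_leqP => y _.
have vu : adj v u by rewrite adj_sym.
have [/orP xa /orP yb] := (dom x, dom y); rewrite ![adj y _]adj_sym in yb.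
case: xa yb => [xu|xv] [uy|vy].
- by apply: leq_trans (dist_walk (p := [:: u; y]) _) _; rewrite /= ?xu ?uy.
- by apply: (dist_walk (p := [:: u; v; y])); rewrite /= xu uv vy.
- by apply: (dist_walk (p := [:: v; u; y])); rewrite /= xv vu uy.
- by apply: leq_trans (dist_walk (p := [:: v; y]) _) _; rewrite /= ?xv ?vy.
Qed.

(** * Trees of diameter at most 3 *)

Definition joint_nbhd u v : {set G} := [set x | adj x u || adj x v].

Lemma joint_nbhdC u v : joint_nbhd u v = joint_nbhd v u.
Proof. by apply/setP => x; rewrite !inE orbC. Qed.

(** Otherwise w - z - u - v is a path. A further neighbour of v would make it a
    path with 4 edges; without one, the joint neighbourhood of z and u contains
    that of u and v, and w in addition. *)
Lemma max_joint_nbhd_closed u v w z :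
  acyclic G -> diam G <= 3 -> adj u v ->
  (forall s t, adj s t -> #|joint_nbhd s t| <= #|joint_nbhd u v|) ->
  adj z u -> adj w z -> w \in joint_nbhd u v.
Proof.
move=> acG diam3 uv max_uv zu wz; rewrite inE; apply/negP => /negP.
rewrite negb_or => /andP[wu wv].
have vu : adj v u by rewrite adj_sym.
have leaf y : adj y v -> y = u.
  move=> yv; apply/eqP; apply/negP => /negP y_u.
  suff: dist w y <= 3.
    have pp : path (@adj G) w [:: z; u; v; y].
      by rewrite /= wz zu uv adj_sym yv.
    rewrite (dist_acyclic acG pp) //= !inE !negb_or.
    rewrite (adj_neq wz) (adj_neq zu) (adj_neq uv) [v == y]eq_sym (adj_neq yv).
    rewrite [u == y]eq_sym y_u !andbT !andTb.
    have zv := acyclic_no_triangle acG zu uv.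
    rewrite -!andbA; apply/and5P; split.
    - by apply: contraNneq wv => ->.
    - by apply: contraNneq wu => ->.
    - by apply: contraNneq wv => ->.
    - by apply: contraNneq wv => <-.
    - by apply: contraNneq zv => ->.
  exact: leq_trans (leq_dist_diam w y) diam3.
suff /proper_card : joint_nbhd u v \proper joint_nbhd z u.
  by rewrite ltnNge max_uv.
apply/properP; split; last by exists w; rewrite inE ?wz // negb_or wu.
apply/subsetP => x; rewrite !inE => /orP[->|/leaf->]; first by rewrite orbT.
by rewrite adj_sym zu.
Qed.

Lemma diam_dominating_edge :
  is_tree G -> (exists x y, adj x y) -> diam G <= 3 ->
  exists u v, dominating_edge u v.
Proof.
move=> [coG acG] [x0 [y0 xy0]] diam3.
have [[u v] /= uv max_uv] :=
  @arg_maxnP _ (x0, y0) (fun e : G * G => adj e.1 e.2)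
    (fun e => #|joint_nbhd e.1 e.2|) xy0.
have {}max_uv s t : adj s t -> #|joint_nbhd s t| <= #|joint_nbhd u v|.
  exact: (max_uv (s, t)).
have clos z w : z \in joint_nbhd u v -> adj z w -> w \in joint_nbhd u v.
  rewrite inE [adj z w]adj_sym => /orP[zu|zv] wz.
    exact: (max_joint_nbhd_closed acG diam3 uv max_uv zu wz).
  have vu : adj v u by rewrite adj_sym.
  rewrite joint_nbhdC; apply: (max_joint_nbhd_closed acG diam3 vu _ zv wz).
  by move=> s t /max_uv; rewrite [joint_nbhd v u]joint_nbhdC.
exists u, v; split=> // x.
suff: x \in joint_nbhd u v by rewrite inE.
have: u \in joint_nbhd u v by rewrite inE uv orbT.
have /connectP[p + ->] := coG u x.
elim: p {1 2 4}u => [|t p IHp] s //= /andP[st pp] sN.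
exact: IHp pp (clos _ _ sN st).
Qed.

(** * Total mixed dominating pairs *)

Lemma adj_or_inc_irrefl a : adj_or_inc a a = false.
Proof. by case: a => [x|e] /=; rewrite ?adj_irrefl ?eqxx. Qed.

Lemma dominated S a : total_mixed_dominating S -> a \in elements G ->
  exists2 b, b \in S & adj_or_inc a b.
Proof. by case/andP=> _ /forall_inP dS /dS/exists_inP. Qed.

Lemma vertex_element x : inl x \in elements G.
Proof. by rewrite inE. Qed.

(** An element dominating some vertex must itself be dominated, and not by
    itself. *)
Lemma total_mixed_dominating_geq2 S : total_mixed_dominating S -> 2 <= #|S|.
Proof.
move=> dS; have /card_gt0P[x _] := sgraph_nonempty G.
have [b bS _] := dominated dS (vertex_element x).
have bE : b \in elements G by case/andP: dS => /subsetP/(_ b bS).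
have [c cS bc] := dominated dS bE.
have b_c : b != c by apply: contraTneq bc => ->; rewrite adj_or_inc_irrefl.
apply: leq_trans (subset_leq_card (A := [set b; c]) _); first by rewrite cards2 b_c.
by rewrite subUset !sub1set bS.
Qed.

Lemma edge_at e s : e \in edges G -> s \in e -> exists2 t, adj s t & e = [set s; t].
Proof.
case/imset2P=> x y _; rewrite inE => /andP[_ xy] ->.
rewrite !inE => /orP[]/eqP->; first by exists y.
by exists x; [rewrite adj_sym | rewrite setUC].
Qed.

(** If the set is a vertex u and an edge uv, or two edges uv and uw, every vertex
    other than u is a neighbour of u, so uv is dominating. *)
Lemma pair_dominating_edge S :
  total_mixed_dominating S -> #|S| = 2 -> exists u v, dominating_edge u v.
Proof.
move=> dS /eqP/cards2P[a [b [_ SE]]].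
have aS : a \in S by rewrite SE !inE eqxx.
have bS : b \in S by rewrite SE !inE eqxx orbT.
have /subsetP sE : S \subset elements G by case/andP: dS.
have dom x : adj_or_inc (inl x) a || adj_or_inc (inl x) b.
  have [c] := dominated dS (vertex_element x).
  by rewrite SE !inE => /orP[]/eqP-> ->; rewrite ?orbT.
have ab : adj_or_inc a b.
  have [c] := dominated dS (sE a aS).
  by rewrite SE !inE => /orP[]/eqP-> //; rewrite adj_or_inc_irrefl.
have vertex_edge u e : e \in edges G -> u \in e ->
    (forall x, adj x u || (x \in e)) -> exists u' v', dominating_edge u' v'.
  move=> eE /(edge_at eE)[v uv ->] {}dom; exists u, v; split=> // x.
  case/orP: (dom x) => [->//|]; rewrite !inE => /orP[]/eqP->.
    by rewrite uv orbT.
  by rewrite adj_sym uv.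
case: a b ab dom aS bS {SE} => [u|e] [v|f] /=.
- by move=> uv dom _ _; exists u, v.
- by move=> uf dom _ /sE; rewrite inE => fE; apply: vertex_edge fE uf dom.
- move=> ve dom /sE; rewrite inE => eE _; apply: vertex_edge eE ve _ => x.
  by rewrite orbC.
move=> /andP[_ /set0Pn[s /setIP[se sf]]] dom /sE + /sE.
rewrite !inE => eE fE; apply: (vertex_edge s e) => // x.
case/orP: (dom x) => [->|]; first by rewrite orbT.
have [t st ->] := edge_at fE sf.
rewrite !inE => /orP[]/eqP->; first by rewrite se orbT.
by rewrite adj_sym st.
Qed.

(** An edge xy avoiding both u and v would be a second path from x to y, next to
    the one going through u, through v, or through both. *)
Lemma dominating_edge_covers u v x y :
  acyclic G -> dominating_edge u v -> adj x y ->
  (u \in [set x; y]) || (v \in [set x; y]).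
Proof.
move=> acG [uv dom] xy; apply/negP => /negP.
rewrite !inE !negb_or => /andP[/andP[ux uy] /andP[vx vy]].
have square s t : adj s t -> adj x s -> adj y t -> s != y -> t != x -> False.
  move=> st xs yt s_y t_x.
  have:= @acyclic_path_unique x [:: y] [:: s; t; y] acG.
  rewrite /= xy xs st adj_sym yt !inE !negb_or (adj_neq xy) (adj_neq xs).
  rewrite (adj_neq st) s_y eq_sym t_x eq_sym (adj_neq yt).
  by move=> /(_ isT isT isT isT erefl).
have vu : adj v u by rewrite adj_sym.
case/orP: (dom x) => xs; case/orP: (dom y) => yt.
- by have := acyclic_no_triangle acG xy yt; rewrite xs.
- exact: square uv xs yt uy vx.
- exact: square vu xs yt vy ux.
- by have := acyclic_no_triangle acG xy yt; rewrite xs.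
Qed.

Lemma dominating_edge_pair u v :
  acyclic G -> dominating_edge u v ->
  total_mixed_dominating [set inl u; inl v : G + {set G}].
Proof.
move=> acG duv; apply/andP; split.
  by apply/subsetP => a; rewrite !inE => /orP[]/eqP->.
have uS : inl u \in [set inl u; inl v : G + {set G}] by rewrite !inE eqxx.
have vS : inl v \in [set inl u; inl v : G + {set G}] by rewrite !inE eqxx orbT.
apply/forall_inP => -[x _|e eE]; apply/exists_inP.
  by case/orP: (duv.2 x) => ?; [exists (inl u) | exists (inl v)].
move: eE; rewrite inE => /imset2P[x y _]; rewrite inE => /andP[_ xy] ->.
case/orP: (dominating_edge_covers acG duv xy) => ?.
  by exists (inl u).
by exists (inl v).
Qed.

Lemma connected_no_isolated :
  gconnected G -> 2 <= #|G| -> forall x, exists y, adj x y.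
Proof.
move=> coG G2 x.
have /card_gt0P[y] : 0 < #|[set~ x]| by rewrite cardsC1; case: #|G| G2 => [|[]].
rewrite !inE => y_x; have /connectP[[|z p] /=] := coG x y.
  by move=> _ yE; rewrite yE eqxx in y_x.
by case/andP=> xz _ _; exists z.
Qed.

End Theory.

(** * The characterization *)

Theorem theorem2p10 (T : sgraph) (hT : is_tree T) (hn : 2 <= #|T|) :
  gamma_tm T = 2 <-> diam T <= 3.
Proof.
have [coT acT] := hT; have noiso := connected_no_isolated coT hn.
have [[S dS SE] min_gamma] := gamma_tm_spec noiso.
split=> [gamma2|diam3].
  have [u [v /dominating_edge_diam //]] : exists u v : T, dominating_edge u v.
  by apply: (pair_dominating_edge dS); rewrite SE.
have /card_gt0P[x _] := sgraph_nonempty T.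
have [u [v duv]] : exists u v : T, dominating_edge u v.
  by apply: diam_dominating_edge => //; exists x.
apply/eqP; rewrite eqn_leq -{2}SE total_mixed_dominating_geq2 // andbT.
apply: leq_trans (min_gamma _ (dominating_edge_pair acT duv)) _.
by rewrite cards2; case: (_ != _).
Qed.
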